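(* Let $\Omega\subset\mathbf{R}^2$ be a smooth, bounded, convex open set. Assume that $d\in\{2,3,4\}$ and $m\ge d+1$ is an integer. Then there exists $\mu\in\mathcal{A}_d$ such that every $\Lambda(\mu)$-minimizer is connected.
   Context: $\mathbf{N}=\{0,1,2,\dots\}$. $\mathcal{A}_d$ is the set of measures $\mu=2\pi\sum_{k=1}^{md}\delta_{x_k}$ with $x_1,\dots,x_{md}$ distinct points of $\Omega$. A compact set $\Gamma$ is a $\Lambda(\mu)$-minimizer if it minimizes $\mathcal{H}^1(\Gamma)$ among compact sets $\Gamma$ with $\mathrm{spt}\,\mu\subset\Gamma$ such that every connected component $\Sigma$ of $\Gamma$ satisfies $\mathrm{Card}(\Sigma\cap\mathrm{spt}\,\mu)\in m\mathbf{N}$. Since components containing no point of $\mathrm{spt}\,\mu$ can be removed, the minimization is reduced to sets $\Gamma$ whose connected components all contain a positive number of points of $\mathrm{spt}\,\mu$. *)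

(* Defs.v *)
From HB Require Import structures.
From mathcomp Require Import all_boot all_order all_algebra.
From mathcomp Require Import all_classical all_reals all_analysis.

Set Implicit Arguments.
Unset Strict Implicit.
Unset Printing Implicit Defensive.

Import Order.TTheory GRing.Theory Num.Theory.
Import numFieldNormedType.Exports.

Local Open Scope classical_set_scope.
Local Open Scope card_scope.
Local Open Scope ring_scope.

(* The library's norm on R * R is the sup norm; it gives the usual topology,
   bounded sets and (as product sigma-algebra) Borel sets, but lengths are
   measured with [edist] below. *)
Notation plane R := (R * R)%type.

Section PlaneGeometry.
Context {R : realType}.
Implicit Types (A Om Gamma : set (plane R)) (mu : {measure set (plane R) -> \bar R}).

Definition edist (p q : plane R) : R :=
  Num.sqrt ((p.1 - q.1) ^+ 2 + (p.2 - q.2) ^+ 2).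

(* The element 0 only matters for A = set0, where ereal_sup would be -oo. *)
Definition ediam A : \bar R :=
  ereal_sup (0%E |` [set (edist p q)%:E | p in A & q in A]).

Definition hausdorff1_pre (delta : R) A : \bar R :=
  ereal_inf [set (\sum_(0 <= i <oo) ediam (U i))%E |
    U in [set U : nat -> set (plane R) |
           (forall i, (ediam (U i) <= delta%:E)%E) /\ A `<=` \bigcup_i U i]].

Definition hausdorff1 A : \bar R :=
  ereal_sup [set hausdorff1_pre delta A | delta in [set delta : R | 0 < delta]].

Definition iter_deriv (vs : seq (plane R)) (f : plane R -> R) : plane R -> R :=
  foldr (fun v (g : plane R -> R) => fun x => 'D_v g x) f vs.

Definition smooth_on (U : set (plane R)) (f : plane R -> R) : Prop :=
  forall (vs : seq (plane R)) (x : plane R), U x ->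
    differentiable (iter_deriv vs f) x.

(* C^oo boundary: near each boundary point p, Om is the sublevel set {phi < 0}
   of a C^oo function with phi p = 0 and nonzero gradient at p. *)
Definition smooth_domain Om : Prop :=
  forall p, (closure Om `\` interior Om) p ->
    exists (U : set (plane R)) (phi : plane R -> R),
      [/\ open U, U p, smooth_on U phi,
          (phi p = 0 /\ exists v, 'D_v phi p != 0) &
          Om `&` U = [set x | U x /\ phi x < 0]].

Definition spt mu : set (plane R) :=
  [set x | forall U, open U -> U x -> (0 < mu U)%E].

Definition in_Ad (m d : nat) Om mu : Prop :=
  exists x : 'I_(m * d) -> plane R,
    [/\ injective x, (forall k, Om (x k)) &
        forall A, measurable A ->
          mu A = ((2 * pi)%:E * \sum_(k < m * d) \d_(x k) A)%E].

Definition is_component Gamma (Sigma : set (plane R)) : Prop :=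
  exists2 x, Gamma x & Sigma = connected_component Gamma x.

Definition Lambda_admissible (m : nat) mu Gamma : Prop :=
  [/\ compact Gamma, spt mu `<=` Gamma &
      forall Sigma, is_component Gamma Sigma ->
        exists k : nat, (Sigma `&` spt mu) #= `I_(k * m)].

(* Without the second clause, adding an isolated point (of zero length) to a
   minimizer would give a disconnected minimizer. *)
Definition Lambda_reduced (m : nat) mu Gamma : Prop :=
  Lambda_admissible m mu Gamma /\
  forall Sigma, is_component Gamma Sigma -> (Sigma `&` spt mu) !=set0.

Definition Lambda_minimizer (m : nat) mu Gamma : Prop :=
  Lambda_reduced m mu Gamma /\
  forall Gamma', Lambda_reduced m mu Gamma' ->
    (hausdorff1 Gamma <= hausdorff1 Gamma')%E.

End PlaneGeometry.

(* Main.v *)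
From Stdlib Require Import ZArith.
Require Import Defs.
From HB Require Import structures.
From mathcomp Require Import all_boot all_order all_algebra.
From mathcomp Require Import all_classical all_reals all_analysis.
From mathcomp Require Import ssrZ lra ring.
Import Order.TTheory GRing.Theory Num.Theory.
Import numFieldNormedType.Exports.
Local Open Scope classical_set_scope.
Local Open Scope ring_scope.
Import Defs.

Set Implicit Arguments.
Unset Strict Implicit.
Unset Printing Implicit Defensive.

(** Put [d + 1] tiny clusters of points near the first [d + 1] vertices of a fixed, nearly
    regular pentagon scaled to fit in the domain, each cluster having fewer than [m] points.
    This is possible because [m >= d + 1].  A component containing [j * m] points then meets
    at least [j + 1] clusters ([many_quotients]).

    The pentagon is chosen so that the length [L j] of a shortest tree joining [j + 1]
    vertices is, in a suitable unit, at least [785 * j + 21] for [j = 1, 2, 3], whereas a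
    tree through the first [d + 1] vertices exists of length less than [785 * d + 42]: with
    more vertices at hand, additional branching points make a longer tree relatively
    cheaper.  If an admissible set is not connected, its components have weights
    [j_1, ..., j_k] with sum [d <= 4] and [k >= 2], so each weight is at most [3] and the
    total length is at least [785 * d + 21 * k >= 785 * d + 42], up to an error of the size
    of the clusters ([disconnected_ge]).  The tree through all the clusters is connected,
    admissible and strictly shorter ([competitor_short]), so a disconnected set is never
    a minimizer.

    The lower bounds concern arbitrary compact connected sets, and are obtained from the
    covers that define the Hausdorff measure ([hausdorff1_connected_ge]).  The nerve of a
    finite open cover of a connected set is a connected graph; a spanning tree of this graph,
    with a point chosen in each intersection of neighbours, is a tree in the plane through
    the given points, not longer than the sum of the diameters except for an error
    proportional to the mesh.  So it suffices to bound the lengths of trees with two, three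
    or four leaves.  Replacing two leaves [A], [B] with a common neighbour [u] by the apex [E] of an
    equilateral triangle on [AB] does not increase the length, since
    [|u - E| <= |u - A| + |u - B|] ([edist_apex_le]); with a rational approximation of [E]
    this leaves a distance between two explicit points, except for trees that pair the ends
    of crossing diagonals, which are at least as long as the two diagonals together.  The
    finitely many resulting inequalities between integers are checked by evaluation.  Finally, the lengths of distinct components add up because
    covers of small mesh do not see two of them at once ([hausdorff1_bigU_ge]). *)

(* The key [Z] already denotes the scope of the integers [int]. *)
Delimit Scope Z_scope with binZ.

(** * Euclidean distance *)

Section EuclideanDistance.
Context {R : realType}.
Implicit Types p q r : plane R.

Lemma edist_ge0 p q : 0 <= edist p q.
Proof. exact: sqrtr_ge0. Qed.

Lemma edistxx p : edist p p = 0.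
Proof. by rewrite /edist !subrr expr0n addr0 sqrtr0. Qed.

Lemma edistC p q : edist p q = edist q p.
Proof. by rewrite /edist; congr Num.sqrt; ring. Qed.

Lemma sqr_edist p q : edist p q ^+ 2 = (p.1 - q.1) ^+ 2 + (p.2 - q.2) ^+ 2.
Proof. by rewrite sqr_sqrtr // addr_ge0 ?sqr_ge0. Qed.

Lemma edist_le p q x : 0 <= x ->
  (p.1 - q.1) ^+ 2 + (p.2 - q.2) ^+ 2 <= x ^+ 2 -> edist p q <= x.
Proof. by move=> x0 h; rewrite -(ler_sqr (edist_ge0 p q) x0) sqr_edist. Qed.

Lemma edist_ge p q x : 0 <= x ->
  x ^+ 2 <= (p.1 - q.1) ^+ 2 + (p.2 - q.2) ^+ 2 -> x <= edist p q.
Proof. by move=> x0 h; rewrite -(ler_sqr x0 (edist_ge0 p q)) sqr_edist. Qed.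

Lemma dot_le_edist p q (a b : R) : a ^+ 2 + b ^+ 2 <= 1 ->
  a * (p.1 - q.1) + b * (p.2 - q.2) <= edist p q.
Proof.
move=> ab1; set x := p.1 - q.1; set y := p.2 - q.2.
have [h|h] := lerP (a * x + b * y) 0; first exact: le_trans h (edist_ge0 _ _).
apply: edist_ge; first exact: ltW.
rewrite -/x -/y; have := sqr_ge0 (a * y - b * x).
have := sqr_ge0 x; have := sqr_ge0 y; nra.
Qed.

Lemma edist_triangle q p r : edist p r <= edist p q + edist q r.
Proof.
have [/eqP r0|r0] := eqVneq (edist p r) 0.
  by rewrite (eqP r0) addr_ge0 ?edist_ge0.
have h := sqr_edist p r; pose D := edist p r; rewrite -/D in r0 h *.
(* Project both legs on the direction of [p - r]. *)
pose a := (p.1 - r.1) / D; pose b := (p.2 - r.2) / D.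
have ab1 : a ^+ 2 + b ^+ 2 = 1.
  by rewrite /a /b !expr_div_n -mulrDl -h divff // expf_neq0.
have -> : D = a * (p.1 - q.1) + b * (p.2 - q.2) +
  (a * (q.1 - r.1) + b * (q.2 - r.2)).
  transitivity (D ^+ 2 / D); first by rewrite expr2 mulfK.
  by rewrite h /a /b; field.
by apply: lerD; apply: dot_le_edist; rewrite ab1.
Qed.

(** Balls of the topology of the plane are squares, hence the factor [2]. *)
Lemma edist_ball_le p q (e : R) : ball p e q -> edist p q <= 2 * e.
Proof.
move=> [/= h1 h2]; have e0 : 0 <= e by apply: le_trans (ltW h1); exact: normr_ge0.
move: h1 h2; rewrite /ball /= => /ltW h1 /ltW h2.
apply: edist_le; first by rewrite mulr_ge0.
have: `|p.1 - q.1| ^+ 2 <= e ^+ 2 by rewrite ler_sqr ?nnegrE.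
have: `|p.2 - q.2| ^+ 2 <= e ^+ 2 by rewrite ler_sqr ?nnegrE.
rewrite !real_normK ?num_real //; nra.
Qed.

End EuclideanDistance.

(** * Trees through a list of terminals *)

Section SteinerTrees.
Context {R : realType} {I : eqType} (t : I -> plane R).
Implicit Types (p q u v : plane R) (T : seq I) (L : R).

(** A rooted tree drawn in the plane, seen through its root, the list of its leaves and its
    length.  Leaves are indices rather than points, so that several of them may lie at the
    same place; Steiner points are the ends [q] of edges, which are unconstrained. *)
Inductive stree : plane R -> seq I -> R -> Prop :=
| stree_leaf i : stree (t i) [:: i] 0
| stree_edge p q T L : stree q T L -> stree p T (edist p q + L)
| stree_join p T1 T2 L1 L2 :
    stree p T1 L1 -> stree p T2 L2 -> stree p (T1 ++ T2) (L1 + L2).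

(** A chain of edges is at least as long as the distance between its ends, so only the
    first branching matters. *)
Lemma stree_split p T L : stree p T L ->
  (exists2 i, T = [:: i] & edist p (t i) <= L) \/
  exists q T1 T2 L1 L2, [/\ T = T1 ++ T2, (0 < size T1)%N && (0 < size T2)%N,
    stree q T1 L1, stree q T2 L2 & edist p q + (L1 + L2) <= L].
Proof.
have ne q S M : stree q S M -> (0 < size S)%N.
  by elim=> // {}q S1 S2 M1 M2 _ h1 _ _; rewrite size_cat addn_gt0 h1.
elim=> {p T L} [i|p q T L _ [[i -> h]|[r [T1 [T2 [L1 [L2 [-> s s1 s2 h]]]]]]]|].
- by left; exists i => //; rewrite edistxx.
- by left; exists i => //; have := edist_triangle q p (t i); lra.
- right; exists r, T1, T2, L1, L2; split => //.
  by have := edist_triangle q p r; lra.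
- move=> p T1 T2 L1 L2 s1 _ s2 _; right; exists p, T1, T2, L1, L2.
  by rewrite (ne _ _ _ s1) (ne _ _ _ s2) edistxx add0r.
Qed.

Lemma stree1 p a L : stree p [:: a] L -> edist p (t a) <= L.
Proof.
case/stree_split => [[i [->]] //|[q [[|? [|? ?]] [[|? ?] [? [? [//= ]]]]]]].
Qed.

Lemma stree2 p a b L : stree p [:: a; b] L ->
  exists u, edist p u + (edist u (t a) + edist u (t b)) <= L.
Proof.
case/stree_split => [[//]|[u [T1 [T2 [L1 [L2 [e s s1 s2 h]]]]]]].
exists u; case: T1 e s s1 => [//|a1 [|b1 [|? ?]]]; case: T2 s2 => [|c1 [|? ?]] //=.
by move=> s2 [-> ->] _ s1; move: (stree1 s1) (stree1 s2); lra.
Qed.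

(** The two cases are the two ways to cut a list of three leaves. *)
Lemma stree3 p a b c L : stree p [:: a; b; c] L ->
  exists u v,
    edist p u + (edist u (t a) + (edist u v + (edist v (t b) + edist v (t c)))) <= L \/
    edist p u + (edist u (t c) + (edist u v + (edist v (t a) + edist v (t b)))) <= L.
Proof.
case/stree_split => [[//]|[u [T1 [T2 [L1 [L2 [e s s1 s2 h]]]]]]].
case: T1 e s s1 => [//|a1 [|b1 [|? [|? ?]]]];
  case: T2 s2 => [|a2 [|b2 [|? ?]]] //= s2 [-> -> ->] _ s1.
- have [v hv] := stree2 s2; exists u, v; left.
  by move: (stree1 s1) hv; lra.
- have [v hv] := stree2 s1; exists u, v; right.
  by move: (stree1 s2) hv; lra.
Qed.

Lemma stree_len2 p a b L : stree p [:: a; b] L -> edist (t a) (t b) <= L.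
Proof.
move=> /stree2[u]; have := edist_triangle u (t a) (t b).
by rewrite (edistC (t a) u); have := edist_ge0 p u; lra.
Qed.

Lemma stree_len3 p a b c L : stree p [:: a; b; c] L ->
  exists u, edist u (t a) + edist u (t b) + edist u (t c) <= L.
Proof.
move=> /stree3[u [v [h|h]]]; exists v; move: h (edist_ge0 p u).
- by have := edist_triangle u v (t a); rewrite (edistC v u); lra.
- by have := edist_triangle u v (t c); rewrite (edistC v u); lra.
Qed.

(** The length of an H-shaped tree with branching points [u] and [v]. *)
Definition hlen u v a b c d : R :=
  edist u (t a) + edist u (t b) + edist u v + edist v (t c) + edist v (t d).

(** Cutting the list of leaves twice can isolate a pair of neighbours in the cyclic order
    only; the root is forgotten by the triangle inequality. *)
Lemma stree_len4 p a b c d L : stree p [:: a; b; c; d] L ->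
  exists u v, hlen u v a b c d <= L \/ hlen u v a d b c <= L.
Proof.
have tri := @edist_triangle R; have sym := @edistC R; rewrite /hlen.
case/stree_split => [[//]|[q [T1 [T2 [L1 [L2 [e s s1 s2 h]]]]]]].
have pq := edist_ge0 p q.
case: T1 e s s1 => [//|? [|? [|? [|? [|? ?]]]]];
  case: T2 s2 => [|? [|? [|? [|? ?]]]] //= s2 e _ s1;
  case: e s1 s2 => <- <- <- <- s1 s2.
- have [u [v uv]] := stree3 s2; have := stree1 s1.
  have := tri q u (t a); rewrite (sym u q).
  by case: uv => h2 h3 h4; exists u, v; [left|right]; lra.
- have [u hu] := stree2 s1; have [v hv] := stree2 s2; exists u, v; left.
  by have := tri q u v; rewrite (sym u q); lra.
- have [u [v uv]] := stree3 s1; have := stree1 s2.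
  have := tri q u (t d); rewrite (sym u q).
  case: uv => h2 h3 h4; last by exists v, u; left; rewrite (sym v u); lra.
  by exists u, v; right; lra.
Qed.

End SteinerTrees.

(** * Trees in the nerve of a cover *)

Section Nerve.
Context {R : realType} (V : nat -> set (plane R)).
Implicit Types (C : set (plane R)) (s D : seq nat).

(** The vertices of a subtree of the nerve, in an order in which each one is a leaf
    of the tree spanned by those after it. *)
Inductive grown : seq nat -> Prop :=
| grown1 i : grown [:: i]
| grownS i j s : grown s -> i \in s -> j \notin s -> V i `&` V j !=set0 ->
    grown (j :: s).

Lemma grown_uniq s : grown s -> uniq s.
Proof. by elim=> // i j {}s _ us _ js _ /=; rewrite js. Qed.

Lemma open_bigcup_seq s : (forall i, open (V i)) -> open (\bigcup_(i in [set` s]) V i).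
Proof. by move=> oV; apply: bigcup_open => i _; exact: oV. Qed.

Lemma grown_step C D s : connected C -> (forall i, open (V i)) ->
  C `<=` \bigcup_(i in [set` D]) V i -> C `&` \bigcup_(i in [set` s]) V i !=set0 ->
  grown s -> {subset s <= D} -> ~ C `<=` \bigcup_(i in [set` s]) V i ->
  exists2 j, j \in D & grown (j :: s).
Proof.
move=> cC oV CD C0 gs sD nC; apply: contrapT => no; apply: nC.
set A := \bigcup_(i in [set` s]) V i.
pose B := \bigcup_(i in [set` [seq i <- D | i \notin s]]) V i.
have CAB x : C x -> ~ A x -> B x.
  move=> /CD[j /= jD Vj] nA; exists j => //=.
  by rewrite mem_filter jD andbT; apply/negP => js; apply: nA; exists j.
have AB : A `&` B = set0.
  rewrite -subset0 => x [[i /= si Vi] [j /=]]; rewrite mem_filter => /andP[js jD] Vj.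
  by apply: no; exists j => //; apply: grownS si js _ => //; exists x.
have CA : C `&` A = C.
  apply: cC => //; first by exists A => //; exact: open_bigcup_seq.
  exists (~` B); first by rewrite closedC; exact: open_bigcup_seq.
  apply/seteqP; split=> x [Cx]; last by move=> nB; split=> //; apply: contrapT => /(CAB _ Cx).
  by move=> Ax; split=> // Bx; have : (A `&` B) x by []; rewrite AB.
by rewrite -CA; apply: subIsetr.
Qed.

(** A connected set cannot be exhausted by two groups of members of an open cover
    without a member of one meeting a member of the other, so a maximal subtree of
    the nerve covers the whole set. *)
Lemma connected_grown C D : connected C -> C !=set0 -> (forall i, open (V i)) ->
  C `<=` \bigcup_(i in [set` D]) V i ->
  exists s, grown s /\ C `<=` \bigcup_(i in [set` s]) V i.
Proof.
move=> cC [x Cx] oV CD; have [i0 /= i0D Vi0] := CD _ Cx.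
apply: contrapT => no.
have long n : exists s, [/\ grown s, {subset s <= D}, size s = n.+1 & i0 \in s].
  elim: n => [|n [s [gs sD szs i0s]]].
    exists [:: i0]; split; rewrite ?mem_head //; first exact: grown1.
    by move=> i; rewrite inE => /eqP ->.
  have C0 : C `&` \bigcup_(i in [set` s]) V i !=set0.
    by exists x; split=> //; exists i0.
  have nC : ~ C `<=` \bigcup_(i in [set` s]) V i by move=> Cs; apply: no; exists s.
  have [j jD gj] := grown_step cC oV CD C0 gs sD nC.
  exists (j :: s); split; rewrite /= ?szs // ?inE ?i0s ?orbT //.
  by move=> i; rewrite inE => /predU1P[->|/sD].
have [s [/grown_uniq us sD szs _]] := long (size D).
by have := uniq_leq_size us sD; rewrite szs ltnn.
Qed.

(** ** From a tree in the nerve to a tree in the plane *)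

Context {I : eqType} (t : I -> plane R) (w : nat -> R) (delta : R).
Hypothesis w_ge0 : forall i, 0 <= w i.
Hypothesis w_le : forall i, w i <= delta.
Hypothesis V_w : forall i p q, V i p -> V i q -> edist p q <= w i.

(** Trees in the plane attached to a vertex of the nerve; a tuple, for the sake of its
    decidable equality. *)
Definition twig : Type := nat * (plane R * seq I * R).
Definition iroot (x : twig) := x.1.
Definition root (x : twig) := x.2.1.1.
Definition leaves (x : twig) := x.2.1.2.
Definition len (x : twig) := x.2.2.

Definition twig_ok (x : twig) :=
  V (iroot x) (root x) /\ stree t (root x) (leaves x) (len x).

Definition all_leaves (X : seq twig) := flatten (map leaves X).

(** Twigs attached at one vertex are joined into a single one; each pays for an edge
    inside the member of the cover, and all but one of these edges are charged to
    the mesh of the cover. *)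
Lemma gather j q X : V j q -> X != [::] ->
  (forall x, x \in X -> twig_ok x /\ iroot x = j) ->
  exists L, stree t q (all_leaves X) L /\
    L + delta <= \sum_(x <- X) len x + w j + (size X)%:R * delta.
Proof.
move=> Vq; case: X => // x X _; elim: X x => [|y X IH] x okX.
  have [[Vx sx] xj] := okX x (mem_head _ _).
  exists (edist q (root x) + len x); split.
    by rewrite /all_leaves /= cats0; exact: stree_edge.
  by rewrite big_seq1 /=; have := V_w Vq; rewrite -xj => /(_ _ Vx); lra.
have [[Vx sx] xj] := okX x (mem_head _ _).
have [z zX|L [sL hL]] := IH y; first by apply: okX; rewrite inE zX orbT.
exists (edist q (root x) + len x + L); split.
  by rewrite /all_leaves /=; apply: stree_join; first exact: stree_edge.
rewrite big_cons /= -[(size X).+2]addn1 natrD mulrDl mul1r; move: hL => /=.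
have := V_w Vq; rewrite -xj => /(_ _ Vx); have := w_le (iroot x).
by rewrite xj; lra.
Qed.

(** Removing the leaves of the tree in the nerve one after the other, and passing their
    twigs on to the neighbour, collects all the twigs. *)
Lemma grown_merge s X : grown s -> X != [::] ->
  (forall x, x \in X -> twig_ok x /\ iroot x \in s) ->
  exists q T L, [/\ stree t q T L, perm_eq T (all_leaves X) &
    L <= \sum_(x <- X) len x + \sum_(i <- s) w i + (size X)%:R * delta].
Proof.
have delta0 : 0 <= delta by exact: le_trans (w_ge0 0) (w_le 0).
move=> gs; elim: gs X => {s} [i|i j s gs IH si js [q [Viq Vjq]]] X X0 okX.
  case: X X0 okX => // x X _ okX; have [[Vx _]] := okX x (mem_head _ _).
  rewrite inE => /eqP xi; rewrite xi in Vx.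
  have [//|y yX|L [sL hL]] := @gather i (root x) (x :: X) Vx.
    by have [? ] := okX y yX; rewrite inE => /eqP.
  exists (root x), (all_leaves (x :: X)), L; split=> //.
  by rewrite big_seq1; lra.
pose A := [seq x <- X | iroot x == j]; pose B := [seq x <- X | iroot x != j].
have pX : perm_eq (A ++ B) X by rewrite perm_filterC.
have okB x : x \in B -> twig_ok x /\ iroot x \in s.
  rewrite mem_filter => /andP[xj /okX[ok]].
  by rewrite inE (negbTE xj) => xs.
have szX : (size X)%:R = (size A)%:R + (size B)%:R :> R.
  by rewrite -natrD -size_cat (perm_size pX).
have sumX : \sum_(x <- X) len x = \sum_(x <- A) len x + \sum_(x <- B) len x.
  by rewrite -big_cat; apply/esym/perm_big.
have lX : perm_eq (all_leaves A ++ all_leaves B) (all_leaves X).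
  by rewrite /all_leaves -flatten_cat -map_cat; apply/perm_flatten/perm_map.
have wj := w_ge0 j; rewrite big_cons.
have [A0|A0] := eqVneq A [::].
  have B0 : B != [::].
    apply: contraNneq X0 => B0; move: pX; rewrite A0 B0 /= perm_sym.
    by move=> /perm_nilP ->.
  have [p [T [L [sT pT hL]]]] := IH B B0 okB.
  exists p, T, L; split=> //; first by apply: perm_trans pT _; rewrite A0 in lX.
  by rewrite szX sumX A0 big_nil add0r add0r; lra.
have [y|M [sM hM]] := @gather j q A Vjq A0.
  by rewrite mem_filter => /andP[/eqP yj /okX[]].
pose y : twig := (i, (q, all_leaves A, M)).
have [//|x|p [T [L [sT pT hL]]]] := IH (y :: B).
  by rewrite inE => /predU1P[->|/okB].
exists p, T, L; split=> //; first exact: perm_trans pT lX.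
move: hL; rewrite big_cons /= -[(size B).+1]addn1 natrD szX sumX.
by rewrite (_ : len y = M) //; lra.
Qed.

End Nerve.

(** * The one-dimensional Hausdorff measure *)

Section Hausdorff.
Context {R : realType}.
Implicit Types (A B C : set (plane R)) (U : nat -> set (plane R)) (delta : R).

Lemma ediam_ge0 A : (0 <= ediam A)%E.
Proof. by apply: ereal_sup_ubound; left. Qed.

Lemma ediam_le A x : 0 <= x ->
  (forall p q, A p -> A q -> edist p q <= x) -> (ediam A <= x%:E)%E.
Proof.
move=> x0 h; apply: ge_ereal_sup => _ [->|[p Ap [q Aq <-]]]; rewrite lee_fin //.
exact: h.
Qed.

Lemma edist_le_ediam A p q : A p -> A q -> ((edist p q)%:E <= ediam A)%E.
Proof. by move=> Ap Aq; apply: ereal_sup_ubound; right; exists p => //; exists q. Qed.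

Lemma ediam0 : ediam (set0 : set (plane R)) = 0%E.
Proof. by apply/eqP; rewrite eq_le ediam_ge0 andbT; exact: ediam_le. Qed.

Lemma hausdorff1_pre_le delta A : 0 < delta -> (hausdorff1_pre delta A <= hausdorff1 A)%E.
Proof. by move=> d0; apply: ereal_sup_ubound; exists delta. Qed.

Lemma hausdorff1_ge0 A : (0 <= hausdorff1 A)%E.
Proof.
apply: le_trans (hausdorff1_pre_le A ltr01).
by apply: le_ereal_inf_tmp => _ [U _ <-]; apply: nneseries_ge0 => *; exact: ediam_ge0.
Qed.

Lemma le_hausdorff1 A B : A `<=` B -> (hausdorff1 A <= hausdorff1 B)%E.
Proof.
move=> AB; apply: ge_ereal_sup => _ [delta d0 <-].
apply: le_trans (hausdorff1_pre_le B d0); apply: ereal_inf_le_tmp => _ [U [dU BU] <-].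
by exists U => //; split=> //; exact: subset_trans AB BU.
Qed.

(** Fine covers do not see two separated sets at once. *)
Lemma hausdorff1_pre_separated delta A B :
  (forall p q, A p -> B q -> delta < edist p q) ->
  (hausdorff1_pre delta A + hausdorff1_pre delta B <= hausdorff1_pre delta (A `|` B))%E.
Proof.
move=> AB; apply: le_ereal_inf_tmp => _ [U [dU ABU] <-].
pose meet (S : set (plane R)) i := if `[< U i `&` S !=set0 >] then U i else set0.
have le_pre S : S `<=` A `|` B ->
    (hausdorff1_pre delta S <= \sum_(0 <= i <oo) ediam (meet S i))%E.
  move=> SAB; apply: ereal_inf_lbound; exists (meet S) => //; split.
    rewrite /meet => i; case: ifP => _ //.
    by rewrite ediam0; apply: le_trans (dU i); exact: ediam_ge0.
  move=> x Sx; have [i _ Uix] := ABU _ (SAB _ Sx); exists i => //.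
  by rewrite /meet; case: asboolP => // -[]; exists x.
apply: le_trans (leeD (le_pre A _) (le_pre B _)) _; [by move=> x; left|by move=> x; right|].
rewrite -nneseriesD; try by move=> *; exact: ediam_ge0.
apply: lee_nneseries => i _; first by rewrite adde_ge0 ?ediam_ge0.
rewrite /meet; case: asboolP => [[p [Uip Ap]]|_]; case: asboolP => [[q [Uiq Bq]]|_];
  rewrite ?ediam0 ?adde0 ?add0e ?ediam_ge0 //.
have := le_trans (edist_le_ediam Uip Uiq) (dU i).
by rewrite lee_fin leNgt AB.
Qed.

Lemma hausdorff1_pre_antimono delta eps A : delta <= eps ->
  (hausdorff1_pre eps A <= hausdorff1_pre delta A)%E.
Proof.
move=> de; apply: ereal_inf_le_tmp => _ [U [dU AU] <-]; exists U => //; split=> // i.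
by apply: le_trans (dU i) _; rewrite lee_fin.
Qed.

(** The minimum of the squared distance on [A `*` B] is attained, hence positive. *)
Lemma compact_separated A B : compact A -> compact B -> A `&` B = set0 ->
  exists2 delta : R, 0 < delta & forall p q, A p -> B q -> delta < edist p q.
Proof.
move=> cA cB AB; have [->|/set0P[a Aa]] := eqVneq A set0; first by exists 1.
have [->|/set0P[b Bb]] := eqVneq B set0; first by exists 1.
pose f (z : plane R * plane R) : R := (z.1.1 - z.2.1) ^+ 2 + (z.1.2 - z.2.2) ^+ 2.
have cf : continuous f.
  have cfst (T1 T2 : topologicalType) : continuous (fst : T1 * T2 -> T1).
    by case=> ? ?; exact: cvg_fst.
  have csnd (T1 T2 : topologicalType) : continuous (snd : T1 * T2 -> T2).
    by case=> ? ?; exact: cvg_snd.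
  have c11 (z : plane R * plane R) : y.1.1 @[y --> z] --> z.1.1.
    by apply: (@continuous_comp _ _ _ fst fst); [exact: cfst|exact: cfst].
  have c12 (z : plane R * plane R) : y.1.2 @[y --> z] --> z.1.2.
    by apply: (@continuous_comp _ _ _ fst snd); [exact: cfst|exact: csnd].
  have c21 (z : plane R * plane R) : y.2.1 @[y --> z] --> z.2.1.
    by apply: (@continuous_comp _ _ _ snd fst); [exact: csnd|exact: cfst].
  have c22 (z : plane R * plane R) : y.2.2 @[y --> z] --> z.2.2.
    by apply: (@continuous_comp _ _ _ snd snd); [exact: csnd|exact: csnd].
  have fz (z : plane R * plane R) : f y @[y --> z] --> f z.
    have c1 : (y.1.1 - y.2.1) @[y --> z] --> z.1.1 - z.2.1.
      by apply: cvgB; [exact: c11|exact: c21].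
    have c2 : (y.1.2 - y.2.2) @[y --> z] --> z.1.2 - z.2.2.
      by apply: cvgB; [exact: c12|exact: c22].
    by apply: cvgD; [apply: cvgM; exact: c1|apply: cvgM; exact: c2].
  exact: fz.
have [||c] := @compact_EVT_min _ _ f _ _ (compact_setX cA cB).
- by exists (a, b).
- by apply: continuous_subspaceT => z; exact: cf.
rewrite inE => -[/= Ac Bc] fmin.
have fc : 0 < f c.
  rewrite lt_neqAle addr_ge0 ?sqr_ge0 // andbT eq_sym; apply/eqP => fc0.
  have : (A `&` B) c.1; last by rewrite AB.
  split=> //; suff -> : c.1 = c.2 by [].
  move/eqP: fc0; rewrite paddr_eq0 ?sqr_ge0 // !sqrf_eq0 !subr_eq0 => /andP[/eqP h1 /eqP h2].
  by rewrite (surjective_pairing c.1) h1 h2 -surjective_pairing.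
exists (Num.sqrt (f c) / 2) => [|p q Ap Bq]; first by rewrite divr_gt0 // sqrtr_gt0.
apply: (@lt_le_trans _ _ (Num.sqrt (f c))).
  by rewrite ltr_pdivrMr // mulr_natr mulr2n ltrDl sqrtr_gt0.
by apply: ler_wsqrtr; apply: (fmin (p, q)); rewrite inE.
Qed.

Lemma hausdorff1_approx A (a e : R) : (a%:E <= hausdorff1 A)%E -> 0 < e ->
  exists2 d : R, 0 < d &
    forall delta, delta <= d -> ((a - e)%:E <= hausdorff1_pre delta A)%E.
Proof.
move=> aA e0.
have /ereal_sup_gt[_ [d d0 <-] h] : ((a - e)%:E < hausdorff1 A)%E.
  by apply: lt_le_trans aA; rewrite lte_fin; lra.
exists d => // delta dd; apply: le_trans (ltW h) _; exact: hausdorff1_pre_antimono.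
Qed.

(** Stated with real lower bounds, which avoids the case of infinite measures. *)
Lemma hausdorff1U_ge A B (a b : R) : compact A -> compact B -> A `&` B = set0 ->
  (a%:E <= hausdorff1 A)%E -> (b%:E <= hausdorff1 B)%E ->
  ((a + b)%:E <= hausdorff1 (A `|` B))%E.
Proof.
move=> cA cB AB aA bB; apply/lee_addgt0Pr => e e0.
have [d d0 dAB] := compact_separated cA cB AB.
have e2 : 0 < e / 2 by rewrite divr_gt0.
have [dA dA0 hA] := hausdorff1_approx aA e2.
have [dB dB0 hB] := hausdorff1_approx bB e2.
pose delta := Order.min d (Order.min dA dB).
have delta0 : 0 < delta by rewrite !lt_min d0 dA0.
rewrite -leeBlDr //; apply: le_trans (hausdorff1_pre_le _ delta0).
apply: le_trans (hausdorff1_pre_separated _).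
  apply: le_trans (leeD (hA delta _) (hB delta _)).
  - by rewrite -EFinB -EFinD lee_fin; lra.
  - by rewrite /delta !ge_min lexx !orbT.
  - by rewrite /delta !ge_min lexx !orbT.
by move=> p q Ap Bq; apply: le_lt_trans (dAB p q Ap Bq); rewrite /delta ge_min lexx.
Qed.

Lemma hausdorff1_bigU_ge (s : seq (set (plane R))) (a : set (plane R) -> R) :
  uniq s -> (forall A, A \in s -> compact A) ->
  (forall A B, A \in s -> B \in s -> A != B -> A `&` B = set0) ->
  (forall A, A \in s -> ((a A)%:E <= hausdorff1 A)%E) ->
  ((\sum_(A <- s) a A)%:E <= hausdorff1 (\big[setU/set0]_(A <- s) A))%E.
Proof.
elim: s => [|A s IH] /=; first by rewrite !big_nil hausdorff1_ge0.
case/andP=> As us cs ds hs; rewrite !big_cons.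
have sub B : B \in s -> B \in A :: s by move=> Bs; rewrite inE Bs orbT.
have AA : A \in A :: s by exact: mem_head.
apply: hausdorff1U_ge; [exact: cs| | |exact: hs|].
- rewrite big_seq; elim/big_ind: _ => [|B C|B /sub/cs] //; first exact: compact0.
  exact: compactU.
- rewrite big_seq; elim/big_ind: _ => [|B C hB hC|B Bs]; first by rewrite setI0.
    by rewrite setIUr hB hC setU0.
  by apply: ds => //; [exact: sub|apply: contraNneq As => ->].
apply: IH => //; first by move=> B /sub/cs.
  by move=> B C Bs Cs; apply: ds; exact: sub.
by move=> B /sub/hs.
Qed.

(** The empty set has diameter [0], so a finite cover extends to a sequence of sets at
    no cost. *)
Lemma hausdorff1_pre_seq delta A (s : seq (set (plane R))) : 0 < delta ->
  (forall B, B \in s -> (ediam B <= delta%:E)%E) -> A `<=` \big[setU/set0]_(B <- s) B ->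
  (hausdorff1_pre delta A <= \sum_(B <- s) ediam B)%E.
Proof.
move=> d0 ds As.
have -> : (\sum_(B <- s) ediam B = \sum_(0 <= i <oo) ediam (nth set0 s i))%E.
  rewrite (nneseries_split 0 (size s)); last by move=> *; exact: ediam_ge0.
  rewrite add0n [X in (_ + X)%E]eseries0 ?adde0; first by rewrite [LHS](big_nth set0).
  by move=> i si _; rewrite nth_default // ediam0.
apply: ereal_inf_lbound; exists (nth set0 s) => //; split=> [i|x /As].
  have [si|si] := ltnP i (size s); first by apply: ds; exact: mem_nth.
  by rewrite nth_default // ediam0 lee_fin ltW.
by rewrite -bigcup_seq => -[B /= Bs Bx]; exists (index B s) => //; rewrite nth_index.
Qed.

End Hausdorff.

(** * Lower bounds for the length of connected sets *)

Section ConnectedLength.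
Context {R : realType} {I : eqType} (t : I -> plane R).
Implicit Types (C : set (plane R)) (T : seq I) (delta e : R).

Lemma uniq_sub_iota (s : seq nat) : uniq s ->
  exists n, perm_eq s [seq i <- index_iota 0 n | i \in s].
Proof.
move=> us; exists (\max_(i <- s) i).+1; apply: uniq_perm => //.
  by rewrite filter_uniq // iota_uniq.
move=> i; rewrite mem_filter mem_index_iota leq0n /=.
by case: (boolP (i \in s)) => // si; rewrite ltnS leq_bigmax_seq.
Qed.

Lemma geometric_half_le e s : 0 <= e -> uniq s ->
  \sum_(i <- s) e / 2 ^+ i.+1 <= e.
Proof.
move=> e0 /uniq_sub_iota[n ps]; have half k : \sum_(i < k) e / 2 ^+ i.+1 = e - e / 2 ^+ k.
  elim: k => [|k IH]; first by rewrite big_ord0 expr0 divr1 subrr.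
  by rewrite big_ord_recr /= IH exprS; field.
apply: (@le_trans _ _ (\sum_(i < n) e / 2 ^+ i.+1)); last first.
  by rewrite half gerBl divr_ge0 // exprn_ge0.
rewrite (perm_big _ ps) /= big_filter big_mkcond -(big_mkord xpredT (fun i => e / 2 ^+ i.+1)) /=.
apply: ler_sum => i _.
by case: ifP => // _; rewrite divr_ge0 // exprn_ge0.
Qed.

(** Each member of a cover of diameters at most [delta] is enlarged to an open set;
    the total enlargement is at most [e]. *)
Lemma stree_of_cover C T delta e (U : nat -> set (plane R)) :
  connected C -> compact C -> T != [::] -> (forall i, i \in T -> C (t i)) -> 0 < e ->
  (forall i, (ediam (U i) <= delta%:E)%E) -> C `<=` \bigcup_i U i ->
  exists q T' L, [/\ stree t q T' L, perm_eq T' T &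
    (L%:E <= \sum_(0 <= i <oo) ediam (U i) +
      (4 * e + (size T)%:R * (delta + 4 * e))%:E)%E].
Proof.
move=> cC kC T0 TC e0 dU CU.
pose r i : R := e / 2 ^+ i.+1.
have r0 i : 0 < r i by rewrite divr_gt0 // exprn_gt0.
have re i : r i <= e by rewrite ler_pdivrMr ?exprn_gt0 // ler_pMr // exprn_ege1 // ler1n.
have fU i : ediam (U i) \is a fin_num.
  by rewrite ge0_fin_numE ?ediam_ge0 // (le_lt_trans (dU i)) ?ltry.
pose V i := \bigcup_(u in U i) ball u (r i).
pose w i := fine (ediam (U i)) + 4 * r i.
have oV i : open (V i) by apply: bigcup_open => u _; exact: ball_open.
have w0 i : 0 <= w i by rewrite addr_ge0 ?fine_ge0 ?ediam_ge0 // mulr_ge0 // ltW.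
have wd i : w i <= delta + 4 * e.
  apply: lerD; first by rewrite -lee_fin fineK.
  by rewrite ler_pM2l.
have Vw i p q : V i p -> V i q -> edist p q <= w i.
  move=> [u Uu /edist_ball_le up] [v Uv /edist_ball_le vq].
  have : edist u v <= fine (ediam (U i)) by rewrite -lee_fin fineK // edist_le_ediam.
  have := edist_triangle u p q; have := edist_triangle v u q.
  by rewrite (edistC p u) /w; lra.
have UV i : U i `<=` V i by move=> u Uu; exists u => //; exact: ballxx.
have [D _ CD] : finite_subset_cover [set: nat] V C.
  (* Compactness by open covers is stated for pointed spaces. *)
  pose P : ptopologicalType :=
    HB.pack (plane R) (Topological.class (plane R)) (Pointed.class (plane R)).
  have : cover_compact C by rewrite -(@compact_cover P).
  apply => //.
  by move=> x /CU[i _ Ux]; exists i => //; exact: UV.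
have [i0 i0T] : exists i, i \in T by case: (T) T0 => // i ? _; exists i; exact: mem_head.
have [|s [gs Cs]] := @connected_grown R V C (finmap.enum_fset D) cC _ oV CD.
  by exists (t i0); exact: TC.
have pick i : exists n, i \in T -> n \in s /\ V n (t i).
  case: (boolP (i \in T)) => [iT|]; last by exists 0%N.
  by have [j /= js Vj] := Cs _ (TC _ iT); exists j.
have [v hv] := choice pick.
pose X := [seq (v i, (t i, [:: i], 0)) : @twig R I | i <- T].
have [| |q [T' [L [sL pT hL]]]] := @grown_merge R V I t w (delta + 4 * e) w0 wd Vw s X gs.
- by rewrite -size_eq0 size_map size_eq0.
- by move=> _ /mapP[i /hv[vs Vi] ->]; split=> //; split=> //; exact: stree_leaf.
exists q, T', L; split=> //.
  suff <- : all_leaves X = T by [].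
  by rewrite /all_leaves -map_comp flatten_seq1.
have sX : \sum_(x <- X) len x = 0 by rewrite big_map big1.
apply: le_trans (_ : (\sum_(i <- s) fine (ediam (U i)) +
    (4 * e + (size T)%:R * (delta + 4 * e)))%:E <= _)%E.
  rewrite lee_fin; move: hL; rewrite sX size_map /w big_split /= -mulr_sumr.
  by have := geometric_half_le (ltW e0) (grown_uniq gs); rewrite -/r => h; lra.
rewrite EFinD leeD2r //.
have [n ps] := uniq_sub_iota (grown_uniq gs).
rewrite -sumEFin; under eq_bigr do rewrite fineK //.
apply: le_trans (_ : (\sum_(0 <= i < n) ediam (U i) <= _)%E); last first.
  by apply: nneseries_lim_ge => *; exact: ediam_ge0.
rewrite (perm_big _ ps) big_filter big_mkcond; apply: lee_sum => i _.
by case: ifP => // _; exact: ediam_ge0.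
Qed.

(** Letting the mesh and the enlargement tend to [0], a lower bound for the lengths of the
    trees through some points of a connected set bounds its Hausdorff measure. *)
Lemma hausdorff1_connected_ge C T (b : R) :
  connected C -> compact C -> T != [::] -> (forall i, i \in T -> C (t i)) ->
  (forall q T' L, perm_eq T' T -> stree t q T' L -> b <= L) ->
  (b%:E <= hausdorff1 C)%E.
Proof.
move=> cC kC T0 TC hb; apply/lee_addgt0Pr => e e0.
(* With mesh [d] and total enlargement [d] the error is [4 * d + N * (d + 4 * d) = e]. *)
pose N : R := (size T)%:R; pose d := e / (4 + 5 * N).
have N0 : 0 <= N by rewrite ler0n.
have d0 : 0 < d by rewrite divr_gt0 //; lra.
rewrite -leeBlDr //; apply: le_trans (hausdorff1_pre_le C d0).
apply: le_ereal_inf_tmp => _ [U [dU CU] <-]; rewrite leeBlDr //.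
have [q [T' [L [sL pT hL]]]] := stree_of_cover cC kC T0 TC d0 dU CU.
apply: le_trans (_ : L%:E <= _)%E; first by rewrite lee_fin; exact: hb sL.
apply: le_trans hL _; rewrite leeD2l // lee_fin -/N.
have -> : 4 * d + N * (d + 4 * d) = d * (4 + 5 * N) by ring.
by rewrite /d divfK //; apply: lt0r_neq0; lra.
Qed.

End ConnectedLength.

(** * Networks of segments *)

Section Linked.
Context {T : eqType}.
Implicit Types (vs : seq T) (E : seq (T * T)).

(** Each edge starts at a known vertex and makes its other end known. *)
Fixpoint linked vs E : bool :=
  if E is e :: E' then (e.1 \in vs) && linked (e.2 :: vs) E' else true.

Lemma linked_star vs E : (forall e, e \in E -> e.1 \in vs) -> linked vs E.
Proof.
elim: E vs => //= e E IH vs h; rewrite h ?mem_head //=; apply: IH => f fE.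
by rewrite inE h ?orbT // inE fE orbT.
Qed.

(** Both ends of the first edge are known from the start. *)
Definition rooted E : bool := if E is e :: E' then linked [:: e.1; e.2] E' else true.

End Linked.

Lemma linked_map (T T' : eqType) (f : T -> T') vs E : linked vs E ->
  linked (map f vs) [seq (f e.1, f e.2) | e <- E].
Proof.
elim: E vs => //= e E IH vs /andP[ev le].
by rewrite map_f //=; exact: (IH (e.2 :: vs)).
Qed.

Lemma rooted_map (T T' : eqType) (f : T -> T') E : rooted E ->
  rooted [seq (f e.1, f e.2) | e <- E].
Proof. by case: E => //= e E; exact: linked_map. Qed.

Section Networks.
Context {R : realType}.
Implicit Types (p q : plane R) (e : plane R * plane R) (E : seq (plane R * plane R)).

Definition along p q (x : R) : plane R :=
  (p.1 + x * (q.1 - p.1), p.2 + x * (q.2 - p.2)).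

Definition seg e : set (plane R) := along e.1 e.2 @` `[0, 1].

Lemma along_continuous p q : continuous (along p q).
Proof.
have aff (a b x : R) : a + y * b @[y --> x] --> a + x * b.
  by apply: cvgD; [exact: cvg_cst|apply: cvgM; [exact: cvg_id|exact: cvg_cst]].
have fx (x : R) : along p q y @[y --> x] --> along p q x.
  exact: (cvg_pair (aff p.1 (q.1 - p.1) x) (aff p.2 (q.2 - p.2) x)).
exact: fx.
Qed.

Lemma seg_left e : seg e e.1.
Proof.
exists 0; first by rewrite /= in_itv /= lexx ler01.
by rewrite /along !mul0r !addr0 -surjective_pairing.
Qed.

Lemma seg_right e : seg e e.2.
Proof.
exists 1; first by rewrite /= in_itv /= lexx ler01.
by rewrite /along !mul1r !subrKC -surjective_pairing.
Qed.

Lemma seg_connected e : connected (seg e).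
Proof.
apply: connected_continuous_connected; first exact: segment_connected.
by apply: continuous_subspaceT; exact: along_continuous.
Qed.

Lemma seg_compact e : compact (seg e).
Proof.
apply: continuous_compact; last exact: segment_compact.
by apply: continuous_subspaceT; exact: along_continuous.
Qed.

Lemma edist_along p q x y : edist (along p q x) (along p q y) = `|x - y| * edist p q.
Proof.
rewrite /edist /along /= -sqrtr_sqr -sqrtrM ?sqr_ge0 //; congr Num.sqrt; ring.
Qed.

Definition net E : set (plane R) := \big[setU/set0]_(e <- E) seg e.

Lemma net_compact E : compact (net E).
Proof.
rewrite /net; elim/big_ind: _ => [|A B|e _]; first exact: compact0.
- exact: compactU.
- exact: seg_compact.
Qed.

Lemma net_ends E p : p \in unzip1 E ++ unzip2 E -> net E p.
Proof.
rewrite mem_cat /net -bigcup_seq => /orP[] /mapP[e eE ->].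
  by exists e => //; exact: seg_left.
by exists e => //; exact: seg_right.
Qed.

Lemma linked_connected A vs E : connected A -> (forall v, v \in vs -> A v) ->
  linked vs E -> connected (A `|` net E).
Proof.
rewrite /net; elim: E A vs => [|e E IH] A vs cA vA /=; first by rewrite big_nil setU0.
case/andP=> ev le; rewrite big_cons setUA; apply: IH le => [|v].
  apply: connectedU => //; last exact: seg_connected.
  by exists e.1; split; [exact: vA|exact: seg_left].
by rewrite inE => /predU1P[->|/vA]; [right; exact: seg_right|left].
Qed.

Lemma rooted_connected E : rooted E -> connected (net E).
Proof.
case: E => [_|e E /= rE]; first by rewrite /net big_nil; exact: connected0.
rewrite /net big_cons; apply: linked_connected rE; first exact: seg_connected.
by move=> v; rewrite !inE => /orP[] /eqP ->; [exact: seg_left|exact: seg_right].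
Qed.

(** Equal pieces have diameters that add up exactly to the length of the segment. *)
Lemma seg_cover e (delta : R) : 0 < delta ->
  exists s : seq (set (plane R)), [/\ (forall B, B \in s -> (ediam B <= delta%:E)%E),
    seg e `<=` \big[setU/set0]_(B <- s) B &
    (\sum_(B <- s) ediam B <= (edist e.1 e.2)%:E)%E].
Proof.
move=> d0; pose L := edist e.1 e.2; have L0 : 0 <= L by exact: edist_ge0.
have [n n0 Ln] : exists2 n, (0 < n)%N & L / n%:R <= delta.
  exists (Num.trunc (L / delta)).+1 => //.
  rewrite ler_pdivrMr ?ltr0n // mulrC -ler_pdivrMr //.
  exact/ltW/truncnS_gt.
have n0R : 0 < n%:R :> R by rewrite ltr0n.
pose B i := along e.1 e.2 @` `[i%:R / n%:R : R, i.+1%:R / n%:R].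
have dB i : (ediam (B i) <= (L / n%:R)%:E)%E.
  apply: ediam_le; first by rewrite divr_ge0 // ltW.
  move=> _ _ [x /= + <-] [y /= + <-]; rewrite !in_itv /= => /andP[x1 x2] /andP[y1 y2].
  rewrite edist_along mulrC ler_wpM2l // ler_norml.
  move: x2 y2; rewrite -natr1 mulrDl mul1r.
  by move: x1 y1; set u := _ / _; set v := _^-1 => x1 y1 x2 y2; lra.
exists [seq B i | i <- index_iota 0 n]; split.
- by move=> _ /mapP[i _ ->]; apply: le_trans (dB i) _; rewrite lee_fin.
- move=> _ [x /= + <-]; rewrite in_itv /= => /andP[x0 x1].
  rewrite -bigcup_seq.
  pose i := minn (Num.trunc (x * n%:R)) n.-1.
  exists (B i).
    by rewrite /=; apply/mapP; exists i => //; rewrite mem_index_iota /= /i gtn_min prednK ?leqnn ?orbT.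
  exists x => //=; rewrite in_itv /= ler_pdivrMr // ler_pdivlMr //.
  have xn : 0 <= x * n%:R by rewrite mulr_ge0 // ltW.
  have /andP[t1 t2] := truncn_itv xn.
  rewrite /i /minn; case: ifP => h; first by rewrite t1 ltW.
  have nt : (n.-1 <= Num.trunc (x * n%:R))%N by rewrite leqNgt h.
  rewrite (le_trans _ t1) ?ler_nat //= prednK //.
  by rewrite -[leRHS]mul1r ler_wpM2r // ltW.
- rewrite big_map; apply: le_trans (lee_sum _ (fun i _ => dB i)) _.
  rewrite sumEFin lee_fin sumr_const_nat subn0 -[_ *+ n]mulr_natr divfK //.
  exact: lt0r_neq0.
Qed.

Lemma hausdorff1_net_le E : (hausdorff1 (net E) <= (\sum_(e <- E) edist e.1 e.2)%:E)%E.
Proof.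
apply: ge_ereal_sup => _ [delta /= d0 <-].
suff [s [ds Es hs]] : exists s : seq (set (plane R)), [/\
    (forall B, B \in s -> (ediam B <= delta%:E)%E),
    net E `<=` \big[setU/set0]_(B <- s) B &
    (\sum_(B <- s) ediam B <= (\sum_(e <- E) edist e.1 e.2)%:E)%E].
  by apply: le_trans hs; exact: hausdorff1_pre_seq.
rewrite /net; elim: E => [|e E [s [ds Es hs]]].
  by exists [::]; split; rewrite ?big_nil.
have [s1 [ds1 es1 hs1]] := seg_cover e d0.
exists (s1 ++ s); split.
- by move=> B; rewrite mem_cat => /orP[/ds1|/ds].
- by rewrite big_cons big_cat /=; exact: setUSS.
- by rewrite !big_cons big_cat EFinD; exact: leeD.
Qed.

End Networks.

(** * Steiner trees on a nearly regular pentagon *)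

Section Apex.
Context {R : realType}.
Implicit Types (p q u v A B C D : plane R).

(** For [k ^+ 2 = 3 / 4] the third vertex of an equilateral triangle on [AB]. *)
Definition apex (k : R) A B : plane R :=
  ((A.1 + B.1) / 2 - k * (B.2 - A.2), (A.2 + B.2) / 2 + k * (B.1 - A.1)).

(** Ptolemy's inequality: for [k ^+ 2 = 3 / 4] the vector from the apex to [u] is the sum of
    the vectors from [A] and [B] to [u], turned by [60] degrees in opposite directions; for
    smaller [k] the two summands only get shorter. *)
Lemma edist_apex_le (k : R) u A B : k ^+ 2 <= 3 / 4 ->
  edist u (apex k A B) <= edist u A + edist u B.
Proof.
move=> hk; pose x := (u.1 - A.1, u.2 - A.2).
pose w : plane R := (u.1 - (x.1 / 2 + k * x.2), u.2 - (x.2 / 2 - k * x.1)).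
have short (a b : R) : (a / 2 + k * b) ^+ 2 + (b / 2 - k * a) ^+ 2 <= a ^+ 2 + b ^+ 2.
  rewrite (_ : _ + _ = (1 / 4 + k ^+ 2) * (a ^+ 2 + b ^+ 2)); last by field.
  by rewrite -[leRHS]mul1r ler_wpM2r ?addr_ge0 ?sqr_ge0 //; lra.
apply: le_trans (edist_triangle w _ _) _; apply: lerD.
  apply: edist_le; rewrite ?edist_ge0 // sqr_edist /w /=.
  by have := short x.1 x.2; rewrite /x /=; lra.
apply: edist_le; rewrite ?edist_ge0 // sqr_edist /w /apex /x /=.
by have := short (u.2 - B.2) (u.1 - B.1); lra.
Qed.

Lemma tripod_ge (k : R) u A B C : k ^+ 2 <= 3 / 4 ->
  edist C (apex k A B) <= edist u A + edist u B + edist u C.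
Proof.
move=> hk; have := edist_triangle u C (apex k A B); rewrite (edistC C u).
by have := edist_apex_le u A B hk; lra.
Qed.

Lemma double_tripod_ge (k l : R) u v A B C D : k ^+ 2 <= 3 / 4 -> l ^+ 2 <= 3 / 4 ->
  edist (apex k A B) (apex l C D) <=
  edist u A + edist u B + edist u v + edist v C + edist v D.
Proof.
move=> hk hl; have := edist_apex_le u A B hk; have := edist_apex_le v C D hl.
have := edist_triangle u (apex k A B) (apex l C D).
by have := edist_triangle v u (apex l C D); rewrite (edistC (apex k A B) u); lra.
Qed.

(** Each half of an H-shaped tree joins two of the points. *)
Lemma double_tripod_crossed_ge u v A B C D :
  edist A B + edist C D <=
  edist u A + edist u B + edist u v + edist v C + edist v D.
Proof.
have := edist_triangle u A B; have := edist_triangle v C D; have := edist_ge0 u v.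
by rewrite (edistC A u) (edistC C v); lra.
Qed.

End Apex.

(** Coordinates are binary integers, so that inequalities between distances can be
    settled by evaluation. *)
Section IntegerPoints.
Context {R : realType}.
Implicit Types (z w : Z * Z) (c : plane R) (s : R).

Definition Zr (a : Z) : R := (int_of_Z a)%:~R.

Lemma ZrD a b : Zr (a + b)%binZ = Zr a + Zr b.
Proof. by rewrite /Zr -rmorphD -raddfD. Qed.

Lemma ZrN a : Zr (- a)%binZ = - Zr a.
Proof. by rewrite /Zr -rmorphN -raddfN. Qed.

Lemma ZrB a b : Zr (a - b)%binZ = Zr a - Zr b.
Proof. by rewrite -ZrN -ZrD. Qed.

Lemma ZrM a b : Zr (a * b)%binZ = Zr a * Zr b.
Proof. by rewrite /Zr -!rmorphM. Qed.

Lemma Zr_nat n : Zr (Z.of_nat n) = n%:R.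
Proof.
elim: n => // n IH; rewrite Nat2Z.inj_succ -Z.add_1_r ZrD IH -natr1.
by congr (_ + _).
Qed.

Lemma Zr_ge0 a : (0 <=? a)%binZ -> 0 <= Zr a.
Proof. by case: a => // p _; rewrite /Zr ler0z. Qed.

Lemma Zr_le a b : (a <=? b)%binZ -> Zr a <= Zr b.
Proof.
move=> ab; rewrite -subr_ge0 -ZrB; apply: Zr_ge0.
by apply/Z.leb_le/Z.le_0_sub; exact/Z.leb_le.
Qed.

Definition place c s z : plane R := (c.1 + s * Zr z.1, c.2 + s * Zr z.2).

Definition Zsqdist z w : Z :=
  ((z.1 - w.1) * (z.1 - w.1) + (z.2 - w.2) * (z.2 - w.2))%binZ.

Lemma sqdist_place c s z w :
  ((place c s z).1 - (place c s w).1) ^+ 2 + ((place c s z).2 - (place c s w).2) ^+ 2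
  = s ^+ 2 * Zr (Zsqdist z w).
Proof. by rewrite /Zsqdist ZrD !ZrM !ZrB /=; ring. Qed.

Lemma edist_place_ge c s z w n : 0 <= s -> (0 <=? n)%binZ -> (n * n <=? Zsqdist z w)%binZ ->
  s * Zr n <= edist (place c s z) (place c s w).
Proof.
move=> s0 /Zr_ge0 n0 /Zr_le; rewrite ZrM => h.
apply: edist_ge; first exact: mulr_ge0.
by rewrite sqdist_place exprMn ler_wpM2l ?sqr_ge0 // expr2.
Qed.

Lemma edist_place_le c s z w n : 0 <= s -> (0 <=? n)%binZ -> (Zsqdist z w <=? n * n)%binZ ->
  edist (place c s z) (place c s w) <= s * Zr n.
Proof.
move=> s0 /Zr_ge0 n0 /Zr_le; rewrite ZrM => h.
apply: edist_le; first exact: mulr_ge0.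
by rewrite sqdist_place exprMn ler_wpM2l ?sqr_ge0 // expr2.
Qed.

(** [433 / 500] is slightly below the half of the square root of three. *)
Definition slope (b : bool) : R := if b then 433 / 500 else - (433 / 500).

Lemma slope_sqr b : slope b ^+ 2 <= 3 / 4.
Proof. by rewrite /slope; case: b; rewrite ?sqrrN; lra. Qed.

(** The apex on a grid a thousand times finer. *)
Definition Zapex (b : bool) z w : Z * Z :=
  let k := if b then 866%binZ else (-866)%binZ in
  ((500 * (z.1 + w.1) - k * (w.2 - z.2))%binZ, (500 * (z.2 + w.2) + k * (w.1 - z.1))%binZ).

Definition Zfine z : Z * Z := ((1000 * z.1)%binZ, (1000 * z.2)%binZ).

Lemma place_apex c s b z w :
  place c (s / 1000) (Zapex b z w) = apex (slope b) (place c s z) (place c s w).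
Proof.
have E500 : Zr 500 = 500 by [].
have E866 : Zr 866 = 866 by [].
have E866N : Zr (-866) = - 866 by rewrite -E866 -ZrN.
rewrite /place /apex /Zapex /slope; cbn [fst snd]; congr pair.
  by rewrite ZrB !ZrM ZrB ZrD E500; case: b; rewrite ?E866 ?E866N; field.
by rewrite ZrD !ZrM ZrB ZrD E500; case: b; rewrite ?E866 ?E866N; field.
Qed.

Lemma place_fine c s z : place c (s / 1000) (Zfine z) = place c s z.
Proof.
have E1000 : Zr 1000 = 1000 by [].
by rewrite /place /Zfine; cbn [fst snd]; rewrite !ZrM E1000; congr pair; field.
Qed.

Lemma edist_fine_ge c s z w n : 0 <= s -> (0 <=? n)%binZ ->
  (1000 * n * (1000 * n) <=? Zsqdist z w)%binZ ->
  s * Zr n <= edist (place c (s / 1000) z) (place c (s / 1000) w).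
Proof.
have E1000 : Zr 1000 = 1000 by [].
move=> s0 n0; have s0' : 0 <= s / 1000 by exact: divr_ge0 s0 (ler0n _ _).
rewrite (_ : s * Zr n = s / 1000 * Zr (1000 * n)%binZ); last first.
  by rewrite ZrM E1000; field.
have n0' : (0 <=? 1000 * n)%binZ.
  by apply/Z.leb_le/Z.mul_nonneg_nonneg => //; exact/Z.leb_le.
exact: (@edist_place_ge c (s / 1000) z w (1000 * n)%binZ s0' n0').
Qed.

End IntegerPoints.

(** A nearly regular pentagon with small integer coordinates (in hundreds).  Its shortest
    side is [806.2] long, and the shortest trees through the first three, four, five vertices
    have lengths close to [1597.2], [2384.5], [3174.4].  The bounds [806], [1591], [2376] used
    below are the values of [785 * j + 21] for [j = 1, 2, 3].  The default value is the fifth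
    vertex. *)
Definition vertex (i : nat) : Z * Z :=
  nth (0, -700)%binZ [:: (700, -300); (600, 500); (-200, 600); (-600, -100)]%binZ i.

Definition bools := [:: true; false].

Definition pair_ok i j := (806 * 806 <=? Zsqdist (vertex i) (vertex j))%binZ.

Definition tripod_ok i j k :=
  has (fun b => (1000 * 1591) * (1000 * 1591) <=?
    Zsqdist (Zfine (vertex k)) (Zapex b (vertex i) (vertex j)))%binZ bools.

(** The first alternative deals with the pairs of crossing diagonals, for which the apexes
    are too close to each other; [1188] is the half of [2376]. *)
Definition double_tripod_ok i j k l :=
  (1188 * 1188 <=? Zsqdist (vertex i) (vertex j))%binZ &&
  (1188 * 1188 <=? Zsqdist (vertex k) (vertex l))%binZ ||
  has (fun b => has (fun b' => (1000 * 2376) * (1000 * 2376) <=?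
    Zsqdist (Zapex b (vertex i) (vertex j)) (Zapex b' (vertex k) (vertex l)))%binZ bools) bools.

Lemma vertices_bounded : all (fun i => let z := vertex i in
  [&& (-700 <=? z.1), (z.1 <=? 700), (-700 <=? z.2) & (z.2 <=? 700)]%binZ) (iota 0 5).
Proof. by vm_compute. Qed.

Lemma pairs_ok : all (fun i => all (fun j => (i != j) ==> pair_ok i j)
  (iota 0 5)) (iota 0 5).
Proof. by vm_compute. Qed.

Lemma tripods_ok : all (fun i => all (fun j => all (fun k =>
  uniq [:: i; j; k] ==> tripod_ok i j k) (iota 0 5)) (iota 0 5)) (iota 0 5).
Proof. by vm_compute. Qed.

Lemma double_tripods_ok : all (fun i => all (fun j => all (fun k => all (fun l =>
  uniq [:: i; j; k; l] ==> double_tripod_ok i j k l) (iota 0 5)) (iota 0 5))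
  (iota 0 5)) (iota 0 5).
Proof. by vm_compute. Qed.

(** Shortest trees through the first [d.+1] vertices, with branching points rounded to
    integers. *)
Definition steiner_tree (d : nat) : seq ((Z * Z) * (Z * Z)) :=
  let v := vertex in
  match d with
  | 2 => let p := (510, 410)%binZ in [:: (v 0, p); (p, v 1); (p, v 2)]
  | 3 => let p := (466, 340)%binZ in let q := (-144, 446)%binZ in
    [:: (v 0, p); (p, v 1); (p, q); (q, v 2); (q, v 3)]
  | 4 => let p := (429, 241)%binZ in let q := (-35, 269)%binZ in
    let r := (-291, -119)%binZ in
    [:: (v 0, p); (p, v 1); (p, q); (q, v 2); (q, r); (r, v 3); (r, v 4)]
  | _ => [::]
  end%N.

(* Rounded up, so as to bound the length of the edge. *)
Definition Zlen (e : (Z * Z) * (Z * Z)) : Z := Z.sqrt_up (Zsqdist e.1 e.2).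

Definition Zlength (E : seq ((Z * Z) * (Z * Z))) : Z :=
  foldr (fun e l => Zlen e + l)%binZ 0%binZ E.

(** The five spare units pay for the clusters. *)
Lemma steiner_trees_ok : all (fun d => let E := steiner_tree d in
  [&& rooted E, all (fun i => vertex i \in unzip1 E ++ unzip2 E) (iota 0 d.+1) &
    (Zlength E + 5 <=? 785 * Z.of_nat d + 42)%binZ]) [:: 2; 3; 4]%N.
Proof. by vm_compute. Qed.

Lemma edist_place_le_Zlen {R : realType} (c : plane R) (s : R) e : 0 <= s ->
  edist (place c s e.1) (place c s e.2) <= s * Zr (Zlen e).
Proof.
move=> s0; have sq0 : (0 <= Zsqdist e.1 e.2)%binZ.
  by apply: Z.add_nonneg_nonneg; exact: Z.square_nonneg.
apply: edist_place_le => //; apply/Z.leb_le; first exact: Z.sqrt_up_nonneg.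
case: (Z.eq_dec (Zsqdist e.1 e.2) 0) => [->|n0]; first exact: Z.square_nonneg.
have [|_ h] := Z.sqrt_up_spec (Zsqdist e.1 e.2); last exact: h.
by apply/Z.le_neq; split => //; exact: not_eq_sym.
Qed.

Lemma tree_length_le {R : realType} (c : plane R) (s : R) E : 0 <= s ->
  \sum_(e <- [seq (place c s e.1, place c s e.2) | e <- E]) edist e.1 e.2 <=
  s * Zr (Zlength E).
Proof.
move=> s0; rewrite big_map; elim: E => [|e E IH]; first by rewrite big_nil mulr0.
by rewrite big_cons /= ZrD mulrDr lerD // edist_place_le_Zlen.
Qed.

Section PentagonTrees.
Context {R : realType} (c : plane R) (s e : R) {I : eqType} (t : I -> plane R).
Context (site : I -> nat).
Hypotheses (s_gt0 : 0 < s) (site_lt : forall i, (site i < 5)%N).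
Let centre i := place c s (vertex (site i)).
Hypothesis t_near : forall i, edist (t i) (centre i) <= e.

Let s_ge0 : 0 <= s := ltW s_gt0.
Let site_iota i : site i \in iota 0 5.
Proof. by rewrite mem_iota site_lt. Qed.

Let e_ge0 i : 0 <= e := le_trans (edist_ge0 _ _) (t_near i).

Lemma near_centre u i : edist u (centre i) - e <= edist u (t i).
Proof. by have := edist_triangle (t i) u (centre i); have := t_near i; lra. Qed.

Lemma centres_apart i j (n : Z) : (0 <=? n)%binZ ->
  (n * n <=? Zsqdist (vertex (site i)) (vertex (site j)))%binZ ->
  s * Zr n <= edist (centre i) (centre j).
Proof. exact: edist_place_ge. Qed.

Lemma pentagon_pair i j : site i != site j ->
  s * 806 - 2 * e <= edist (t i) (t j).
Proof.
move=> ij; have /allP/(_ _ (site_iota i))/allP/(_ _ (site_iota j)) := pairs_ok.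
rewrite ij => h; have {h} := @centres_apart i j 806%binZ isT h.
rewrite (_ : Zr 806 = 806) // => h.
have := near_centre (t i) j; have := near_centre (centre j) i.
by rewrite (edistC (centre j) (t i)) (edistC (centre j) (centre i)); lra.
Qed.

Lemma pentagon_tripod u i j k : uniq [:: site i; site j; site k] ->
  s * 1591 - 3 * e <= edist u (t i) + edist u (t j) + edist u (t k).
Proof.
move=> ijk; have /allP/(_ _ (site_iota i))/allP/(_ _ (site_iota j))
  /allP/(_ _ (site_iota k)) := tripods_ok.
rewrite ijk => /hasP[b _] h.
have {h} : s * Zr 1591 <= edist (centre k) (apex (slope b) (centre i) (centre j)).
  rewrite /centre -(place_fine c s (vertex (site k))) -place_apex.
  exact: (@edist_fine_ge R c s _ _ 1591%binZ s_ge0 isT h).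
rewrite (_ : Zr 1591 = 1591) //.
have := tripod_ge u (centre i) (centre j) (centre k) (slope_sqr b).
have := near_centre u i; have := near_centre u j; have := near_centre u k.
lra.
Qed.

Lemma pentagon_double_tripod u v i j k l : uniq [:: site i; site j; site k; site l] ->
  s * 2376 - 4 * e <= hlen t u v i j k l.
Proof.
move=> ijkl; have /allP/(_ _ (site_iota i))/allP/(_ _ (site_iota j))
  /allP/(_ _ (site_iota k))/allP/(_ _ (site_iota l)) := double_tripods_ok.
have := near_centre u i; have := near_centre u j.
have := near_centre v k; have := near_centre v l; rewrite /hlen.
rewrite ijkl => near_l near_k near_j near_i /orP[/andP[ij kl]|].
  have := double_tripod_crossed_ge u v (centre i) (centre j) (centre k) (centre l).
  have := @centres_apart i j 1188%binZ isT ij; have := @centres_apart k l 1188%binZ isT kl.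
  by rewrite (_ : Zr 1188 = 1188) //; lra.
case/hasP=> b _ /hasP[b' _] h.
have {h} : s * Zr 2376 <=
    edist (apex (slope b) (centre i) (centre j)) (apex (slope b') (centre k) (centre l)).
  by rewrite /centre -!place_apex; exact: (@edist_fine_ge R c s _ _ 2376%binZ s_ge0 isT h).
rewrite (_ : Zr 2376 = 2376) //.
have := double_tripod_ge u v (centre i) (centre j) (centre k) (centre l)
  (slope_sqr b) (slope_sqr b').
lra.
Qed.

Lemma pentagon_tree_ge p T L : stree t p T L -> uniq (map site T) ->
  (1 < size T < 5)%N -> s * (785 * (size T).-1%:R + 21) - 4 * e <= L.
Proof.
case: T => [|i [|j [|k [|l [|? ?]]]]] //= tT uT _; have e0 := e_ge0 i.
- have := stree_len2 tT; have := @pentagon_pair i j; rewrite inE andbT in uT.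
  by move=> /(_ uT); lra.
- have [u hu] := stree_len3 tT; have := pentagon_tripod u uT; lra.
- have [u [v [h|h]]] := stree_len4 tT.
    by have := pentagon_double_tripod u v uT; lra.
  have := @pentagon_double_tripod u v i l j k.
  have /perm_uniq -> : perm_eq [:: site i; site l; site j; site k]
    [:: site i; site j; site k; site l].
    by rewrite perm_cons (perm_catC [:: site l] [:: site j; site k]).
  by move=> /(_ uT); lra.
Qed.

Lemma pentagon_connected_ge C T : connected C -> compact C ->
  (forall i, i \in T -> C (t i)) -> uniq (map site T) -> (1 < size T < 5)%N ->
  ((s * (785 * (size T).-1%:R + 21) - 4 * e)%:E <= hausdorff1 C)%E.
Proof.
move=> cC kC TC uT sT; apply: hausdorff1_connected_ge TC _ => //.
  by case: (T) sT.
move=> q T' L pT sL; rewrite -(perm_size pT).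
apply: pentagon_tree_ge sL _ _; last by rewrite (perm_size pT).
by rewrite (perm_uniq (perm_map _ pT)).
Qed.

End PentagonTrees.

(** * Point measures and the pigeonhole principle *)

Section PointMeasures.
Context {R : realType}.
Local Open Scope card_scope.

Lemma point_measure_exists (x : nat -> plane R) (n : nat) :
  exists mu : {measure set (plane R) -> \bar R},
    forall A, mu A = ((2 * pi)%:E * \sum_(k < n) \d_(x k) A)%E.
Proof.
by exists (mscale (NngNum (mulr_ge0 (ler0n R 2) (pi_ge0 R)))
  (msum (fun k => (\d_(x k) : {measure set (plane R) -> \bar R})) n)).
Qed.

Lemma spt_point_measure (x : nat -> plane R) (n : nat)
    (mu : {measure set (plane R) -> \bar R}) :
  (forall A, mu A = ((2 * pi)%:E * \sum_(k < n) \d_(x k) A)%E) ->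
  spt mu = [set` [seq x k | k <- iota 0 n]].
Proof.
move=> muE; apply/seteqP; split=> p /=.
  move=> sp; apply: contrapT => np.
  have oU : open (~` [set` [seq x k | k <- iota 0 n]]).
    rewrite openC; have /accessible_finite_set_closed : accessible_space (plane R).
      exact/hausdorff_accessible/norm_hausdorff.
    by apply; exact: finite_seq.
  have := sp _ oU np; rewrite muE big1 ?mule0 ?ltxx // => k _.
  rewrite diracE memNset //= => -[]; apply/mapP; exists (val k) => //.
  by rewrite mem_iota /= ltn_ord.
move=> /mapP[k]; rewrite mem_iota /= add0n => kn -> U oU Ux.
rewrite muE mule_gt0 // ?lte_fin ?mulr_gt0 ?pi_gt0 //.
rewrite (bigD1 (Ordinal kn)) //= diracE mem_set //.
apply: (@lt_le_trans _ _ 1%E); first exact: lte01.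
by rewrite leeDl // sume_ge0 // => i _; rewrite diracE lee_fin ler0n.
Qed.

Lemma card_seq (T : choiceType) (s : seq T) : uniq s -> [set` s] #= `I_(size s).
Proof.
case: s => [|x0 s] us; first by rewrite set_nil II0 card_eq00.
have -> : [set` x0 :: s] = nth x0 (x0 :: s) @` `I_(size (x0 :: s)).
  apply/seteqP; split=> [x xs|_ [i is_ <-]]; last exact: mem_nth.
  have ix : (index x (x0 :: s) < size (x0 :: s))%N by rewrite index_mem.
  by exists (index x (x0 :: s)); [exact: ix|exact: nth_index].
apply: inj_card_eq => i j; rewrite !inE => si sj /eqP.
by rewrite nth_uniq // => /eqP.
Qed.

(** Pigeonhole: at most [r] of the indices have the same quotient by [r]. *)
Lemma many_quotients (n r j : nat) (K : seq 'I_n) :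
  (0 < r)%N -> uniq K -> (j * r < size K)%N ->
  exists T, [/\ {subset T <= K}, uniq (map (fun k : 'I_n => k %/ r)%N T) & size T = j.+1].
Proof.
move=> r0; elim: j => [|j IH] uK sK.
  by case: K uK sK => // k K _ _; exists [:: k]; split=> // i; rewrite !inE => ->.
have [|T [TK uT sT]] := IH uK.
  by apply: leq_ltn_trans sK; rewrite leq_mul2r leqnSn orbT.
pose Q := map (fun k : 'I_n => k %/ r)%N T.
have [/hasP[k kK kQ]|/hasPn h] := boolP (has (fun k : 'I_n => k %/ r \notin Q)%N K).
  exists (k :: T); rewrite /= sT kQ uT; split=> // i.
  by rewrite inE => /predU1P[->|/TK].
suff : (size K <= size Q * r)%N by rewrite size_map sT leqNgt sK.
rewrite -(size_map (fun k : 'I_n => (k %/ r, k %% r))%N).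
have -> : (size Q * r)%N = size [seq (q, i) | q <- Q, i <- iota 0 r].
  by rewrite size_allpairs size_iota.
apply: uniq_leq_size => [|_ /mapP[k kK ->]].
  rewrite map_inj_uniq // => k l [e1 e2]; apply: val_inj.
  by rewrite /= (divn_eq k r) (divn_eq l r) e1 e2.
apply/allpairsP; exists (k %/ r, k %% r)%N => /=; rewrite mem_iota ltn_mod r0.
by split=> //; have := h k kK; rewrite negbK.
Qed.

End PointMeasures.


(** * Lengths of disconnected admissible sets *)

Section Disconnected.
Context {R : realType} (c : plane R) (s e : R) (m d : nat).
Context (x : 'I_(m * d) -> plane R) (mu : {measure set (plane R) -> \bar R}).
Let site (k : 'I_(m * d)) := (k %/ m.-1)%N.
Hypotheses (s_gt0 : 0 < s) (e_small : 4 * e <= 21 * s) (m_gt1 : (1 < m)%N) (d_le4 : (d <= 4)%N).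
Hypothesis site_lt : forall k, (site k < 5)%N.
Hypothesis x_near : forall k, edist (x k) (place c s (vertex (site k))) <= e.
Hypothesis x_inj : injective x.
Hypothesis spt_mu : spt mu = [set` map x (enum 'I_(m * d))].

Variable Gamma : set (plane R).
Hypothesis Gamma_reduced : Lambda_reduced m mu Gamma.

Let comp k := connected_component Gamma (x k).
Let comps := undup [seq comp k | k <- enum 'I_(m * d)].
Let indices C := [seq k <- enum 'I_(m * d) | `[< C (x k) >]].

Let x_Gamma k : Gamma (x k).
Proof.
have [[_ + _] _] := Gamma_reduced; apply; rewrite spt_mu /=.
by apply: map_f; rewrite mem_enum.
Qed.

Let compsP C : C \in comps -> exists k, C = comp k.
Proof. by rewrite mem_undup => /mapP[k _ ->]; exists k. Qed.

Let comp_comps k : comp k \in comps.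
Proof. by rewrite mem_undup map_f // mem_enum. Qed.

Let comp_self k : comp k (x k).
Proof. exact: connected_component_refl. Qed.

Let in_comps C k : C \in comps -> C (x k) -> C = comp k.
Proof.
by move=> /compsP[l ->] lk; apply/esym/same_connected_component/connected_component_sym.
Qed.

Let comps_disjoint C D : C \in comps -> D \in comps -> C != D -> C `&` D = set0.
Proof.
move=> /compsP[k ->] /compsP[l ->] kl; rewrite -subset0 => y [ky ly].
case/negP: kl; apply/eqP.
by rewrite /comp (same_connected_component ky) (same_connected_component ly).
Qed.

Let comp_compact C : C \in comps -> compact C.
Proof.
move=> /compsP[k ->]; have [[kG _ _] _] := Gamma_reduced.
apply: (subclosed_compact _ kG); last exact: connected_component_sub.
by apply: component_closed; apply: compact_closed kG; exact: norm_hausdorff.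
Qed.

Let indices_gt0 C : C \in comps -> (0 < size (indices C))%N.
Proof.
move=> /compsP[k ->]; rewrite -has_predT; apply/hasP; exists k => //.
by rewrite mem_filter mem_enum andbT; apply/asboolP.
Qed.

Let indices_dvd C : C \in comps -> (m %| size (indices C))%N.
Proof.
move=> /compsP[k Ck]; have [[_ _ cG] _] := Gamma_reduced.
have [|j hj] := cG C; first by exists (x k).
suff -> : size (indices C) = (j * m)%N by exact: dvdn_mull.
apply/card_eq_II; apply: card_eq_trans hj.
have -> : C `&` spt mu = [set` map x (indices C)].
  rewrite spt_mu; apply/seteqP; split=> y /=.
    move=> [Cy /mapP[l _ yl]]; rewrite yl; apply: map_f.
    by rewrite mem_filter mem_enum andbT; apply/asboolP; rewrite -yl.
  move=> /mapP[l]; rewrite mem_filter => /andP[/asboolP Cl lE] ->.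
  by split=> //; exact: map_f.
rewrite card_eq_sym -(size_map x); apply: card_seq.
by rewrite map_inj_uniq // filter_uniq // enum_uniq.
Qed.

(* The component [C] contains [weight C * m] points. *)
Let weight C := (size (indices C) %/ m)%N.

Let m_gt0 : (0 < m)%N := ltnW m_gt1.

Let weightK C : C \in comps -> (weight C * m)%N = size (indices C).
Proof. by move=> /indices_dvd/divnK. Qed.

Let weight_gt0 C : C \in comps -> (0 < weight C)%N.
Proof. by move=> Cc; rewrite divn_gt0 // dvdn_leq ?indices_gt0 ?indices_dvd. Qed.

Let sum_weight : (\sum_(C <- comps) weight C = d)%N.
Proof.
apply/eqP; rewrite -(eqn_pmul2r m_gt0) big_distrl /= mulnC; apply/eqP.
transitivity (\sum_(C <- comps) \sum_(k < m * d | `[< C (x k) >]) 1)%N.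
  apply: eq_big_seq => C Cc.
  by rewrite weightK // size_filter -sum1_count big_enum_cond.
rewrite (exchange_big_dep xpredT) //=.
transitivity (\sum_(k < m * d) 1)%N; last by rewrite sum1_card card_ord mulnC.
apply: eq_bigr => k _; rewrite sum1_count.
rewrite -[RHS]/(true : nat) -(comp_comps k) -(count_uniq_mem _ (undup_uniq _)).
apply: eq_in_count => C Cc /=; apply/asboolP/eqP => [|->]; last exact: comp_self.
exact: in_comps.
Qed.

Let many_comps : ~ connected Gamma -> (1 < size comps)%N.
Proof.
move=> nc; rewrite ltnNge; apply/negP => sz; apply: nc.
have [[y Gy]|/set0P/negP/negPn/eqP ->] := pselect (Gamma !=set0); last exact: connected0.
have inG z : Gamma z -> exists k, comp k z.
  move=> Gz; have [_ /(_ (connected_component Gamma z))] := Gamma_reduced.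
  case=> [|w [zw]]; first by exists z.
  rewrite spt_mu /= => /mapP[k _ wk]; exists k; apply: connected_component_sym.
  by rewrite -wk.
have same k l : comp k = comp l.
  case: (comps) sz (comp_comps k) (comp_comps l) => [//|C [|//]] _.
  by move=> /predU1P[->|//] /predU1P[->|//].
have [k ky] := inG y Gy; have -> : Gamma = comp k; last exact: component_connected.
apply/seteqP; split=> [z /inG[l]|]; first by rewrite (same l k).
exact: connected_component_sub.
Qed.

Let weight_lt C : ~ connected Gamma -> C \in comps -> (weight C < d)%N.
Proof.
move=> /many_comps two Cc; rewrite -sum_weight (big_rem C Cc) /= -[X in (X < _)%N]addn0.
rewrite ltn_add2l; apply: (@leq_trans (size (rem C comps))).
  by rewrite size_rem // -ltnS prednK // ltnW.
rewrite -sum1_size big_seq [leqRHS]big_seq; apply: leq_sum => D Dr.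
exact/weight_gt0/(mem_rem Dr).
Qed.

(* More than [weight C * m.-1] points, hence more than [weight C] clusters. *)
Let comp_ge C : ~ connected Gamma -> C \in comps ->
  ((s * (785 * (weight C)%:R + 21) - 4 * e)%:E <= hausdorff1 C)%E.
Proof.
move=> nc Cc; have [k Ck] := compsP Cc.
have w0 := weight_gt0 Cc; have wd := weight_lt nc Cc.
have [|||T [TK uT sT]] := @many_quotients _ m.-1 (weight C) (indices C).
- by rewrite -ltnS prednK.
- by rewrite filter_uniq // enum_uniq.
- by rewrite -(weightK Cc) ltn_pmul2l // prednK.
have := @pentagon_connected_ge R c s e _ x site s_gt0 site_lt x_near C T.
rewrite sT; apply => //.
- by rewrite Ck; exact: component_connected.
- exact: comp_compact.
- by move=> l /TK; rewrite mem_filter => /andP[/asboolP].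
- by rewrite ltnS w0 ltnS (leq_trans wd).
Qed.

(** The weights add up to [d], and the constant [21] is gained once for each of the at
    least two components. *)
Lemma disconnected_ge : ~ connected Gamma ->
  ((s * (785 * d%:R + 42) - 8 * e)%:E <= hausdorff1 Gamma)%E.
Proof.
move=> nc; pose a C := s * (785 * (weight C)%:R + 21) - 4 * e.
have sum_a : \sum_(C <- comps) a C =
    s * 785 * d%:R + (21 * s - 4 * e) * (size comps)%:R.
  rewrite -[in RHS]sum_weight natr_sum mulr_sumr -sum1_size natr_sum mulr_sumr -big_split /=.
  by apply: eq_bigr => C _; rewrite /a; ring.
apply: (@le_trans _ _ (\sum_(C <- comps) a C)%:E).
  rewrite lee_fin sum_a.
  have two : 2 <= (size comps)%:R :> R by rewrite ler_nat many_comps.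
  have : (21 * s - 4 * e) * 2 <= (21 * s - 4 * e) * (size comps)%:R.
    by rewrite ler_wpM2l // subr_ge0.
  lra.
apply: le_trans (hausdorff1_bigU_ge (undup_uniq _) comp_compact comps_disjoint _) _.
  by move=> C; exact: comp_ge.
apply: le_hausdorff1; rewrite -bigcup_seq => y [C /= /compsP[k ->]].
exact: connected_component_sub.
Qed.

End Disconnected.

(** * The configuration *)

Section Clusters.
Context {R : realType} (c : plane R) (s : R) (m d : nat).
Hypotheses (s_gt0 : 0 < s) (d_in : d \in [:: 2; 3; 4]%N) (m_ge : (d + 1 <= m)%N).

Let n := (m * d)%N.
(** Small enough for [n + 8] times it not to exceed [s]: the tree to be compared has [n]
    edges inside the clusters, and the lower bound loses [8] radii. *)
Definition cluster_radius : R := s / (n%:R + 8).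
Let e := cluster_radius.

(** The abscissae in a cluster are shifted proportionally to the index, which makes the
    points distinct. *)
Definition cluster_point (k : nat) : plane R :=
  let p := place c s (vertex (k %/ m.-1)) in (p.1 + e / n%:R * k%:R, p.2).

Let d_bounds : (1 < d < 5)%N.
Proof. by move: d_in; rewrite !inE => /or3P[] /eqP ->. Qed.

Let n_gt0 : (0 < n)%N.
Proof.
have /andP[d1 _] := d_bounds.
by rewrite /n muln_gt0 (leq_trans _ m_ge) ?addn1 //= ltnW.
Qed.

Let n8_gt0 : 0 < n%:R + 8 :> R.
Proof. by apply: ltr_wpDl; rewrite ?ler0n ?ltr0n. Qed.

Let e_gt0 : 0 < e.
Proof. exact: divr_gt0 s_gt0 n8_gt0. Qed.

Let e_mul : (n%:R + 8) * e = s.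
Proof. by rewrite /e /cluster_radius mulrC divfK // lt0r_neq0 // n8_gt0. Qed.

(** Since [m * d = (m - 1) * d + d] and [d <= m - 1], clusters of [m - 1] points suffice. *)
Lemma cluster_lt k : (k < n)%N -> (k %/ m.-1 < d.+1)%N.
Proof.
have /andP[d1 _] := d_bounds; move: m_ge; rewrite addn1 /n => dm kn.
have r0 : (d <= m.-1)%N by rewrite -ltnS prednK // (leq_ltn_trans _ dm).
rewrite ltn_divLR; last by apply: leq_trans r0; exact: ltnW.
apply: leq_trans kn _; have -> : (m * d = m.-1 * d + d)%N.
  by rewrite -[in LHS](ltn_predK dm) mulSnr.
by rewrite mulSn [(d * _)%N]mulnC addnC leq_add2r.
Qed.

Let shift_ge0 k : 0 <= e / n%:R * k%:R.
Proof. by rewrite mulr_ge0 // divr_ge0 // ltW. Qed.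

Let shift_le k : (k < n)%N -> e / n%:R * k%:R <= e.
Proof.
move=> kn; rewrite -mulrA ler_piMr ?(ltW e_gt0) // mulrC ler_pdivrMr ?ltr0n // mul1r ler_nat.
exact: ltnW.
Qed.

Lemma cluster_near k : (k < n)%N ->
  edist (cluster_point k) (place c s (vertex (k %/ m.-1))) <= e.
Proof.
move=> kn; have e0 := ltW e_gt0; have s0 := shift_ge0 k; have s1 := shift_le kn.
apply: edist_le => //; rewrite /cluster_point /= subrr addrAC subrr add0r.
by rewrite expr0n addr0 ler_sqr.
Qed.

Lemma cluster_radius_le : 8 * e <= s.
Proof. by have := e_mul; have := mulr_ge0 (ler0n R n) (ltW e_gt0); lra. Qed.

Lemma cluster_ball k : (k < n)%N -> ball c (1000 * s) (cluster_point k).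
Proof.
move=> kn; have kd : (k %/ m.-1)%N \in iota 0 5.
  rewrite mem_iota; apply: leq_trans (cluster_lt kn) _; by case/andP: d_bounds.
have /allP/(_ _ kd)/and4P[/(@Zr_le R) x1 /(@Zr_le R) x2 /(@Zr_le R) y1 /(@Zr_le R) y2] :=
  vertices_bounded.
have E700 : Zr 700 = 700 :> R by [].
rewrite (_ : Zr (-700) = - 700) in x1 y1; last by rewrite (ZrN 700) E700.
rewrite E700 in x2 y2.
have near0 := shift_ge0 k; have near1 := shift_le kn.
have bound (a b : R) : -700 <= a -> a <= 700 -> 0 <= b -> b <= e -> `|- (s * a + b)| < 1000 * s.
  move=> a1 a2 b0 be; rewrite normrN (le_lt_trans (ler_normD _ _)) //.
  rewrite normrM (gtr0_norm s_gt0) (ger0_norm b0).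
  have : s * `|a| <= s * 700 by rewrite ler_wpM2l ?(ltW s_gt0) // ler_norml a1.
  by have := cluster_radius_le; have := s_gt0; lra.
have shift u a b : u - (u + a + b) = - (a + b) :> R by ring.
split; rewrite /ball /=; first by rewrite shift bound.
by rewrite -[_ + s * _]addr0 shift bound // ltW.
Qed.

Lemma cluster_point_inj k l : (k < n)%N -> (l < n)%N ->
  cluster_point k = cluster_point l -> k = l.
Proof.
move=> kn ln kl; have [ks|ks] := eqVneq (k %/ m.-1)%N (l %/ m.-1)%N.
  move: kl => [+ _]; rewrite ks => /addrI /mulfI h.
  by apply/eqP; rewrite -(eqr_nat R) h // lt0r_neq0 // divr_gt0 // ltr0n.
have lt5 (i : 'I_n) : (i %/ m.-1 < 5)%N.
  by apply: leq_trans (cluster_lt (ltn_ord i)) _; case/andP: d_bounds.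
have := @pentagon_pair R c s e 'I_n (fun i => cluster_point i) (fun i => (i %/ m.-1)%N)
  s_gt0 lt5 (fun i => cluster_near (ltn_ord i)) (Ordinal kn) (Ordinal ln) ks.
rewrite /= kl edistxx; move=> far; exfalso.
by move: far; have := cluster_radius_le; have := s_gt0; lra.
Qed.

Let star := [seq (place c s (vertex (k %/ m.-1)), cluster_point k) | k <- iota 0 n].
Let tree := [seq (place c s f.1, place c s f.2) | f <- steiner_tree d].

Definition competitor : set (plane R) := net (tree ++ star).

Let tree_ok : [/\ rooted (steiner_tree d),
  forall i, (i < d.+1)%N -> vertex i \in unzip1 (steiner_tree d) ++ unzip2 (steiner_tree d) &
  (Zlength (steiner_tree d) + 5 <=? 785 * Z.of_nat d + 42)%binZ].
Proof.
have /allP/(_ d d_in)/and3P[h1 /allP h2 h3] := steiner_trees_ok.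
by split=> // i id; apply: h2; rewrite mem_iota.
Qed.

Let tree_ends k : (k < n)%N -> place c s (vertex (k %/ m.-1)) \in unzip1 tree ++ unzip2 tree.
Proof.
move=> /cluster_lt kd; have [_ /(_ _ kd) + _] := tree_ok.
by move=> /(map_f (place c s)); rewrite map_cat /tree /unzip1 /unzip2 -!map_comp.
Qed.

Lemma competitor_connected : connected competitor.
Proof.
have [rT _ _] := tree_ok; have cT : connected (net tree).
  exact/rooted_connected/rooted_map.
rewrite /competitor /net big_cat; apply: linked_connected cT _ _; last first.
  apply: linked_star => f /mapP[k]; rewrite mem_iota /= => kn ->; exact: tree_ends kn.
by move=> v; exact: net_ends.
Qed.

Lemma competitor_point k : (k < n)%N -> competitor (cluster_point k).
Proof.
move=> kn; apply: net_ends; rewrite mem_cat; apply/orP; right.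
apply/mapP; exists (place c s (vertex (k %/ m.-1)), cluster_point k) => //.
by rewrite mem_cat; apply/orP; right; apply/mapP; exists k => //; rewrite mem_iota.
Qed.

Lemma competitor_short :
  (hausdorff1 competitor < (s * (785 * d%:R + 42) - 8 * e)%:E)%E.
Proof.
apply: le_lt_trans (hausdorff1_net_le _) _; rewrite lte_fin big_cat /=.
have [_ _ /(@Zr_le R)] := tree_ok; rewrite !ZrD ZrM Zr_nat => hd.
have := tree_length_le c (steiner_tree d) (ltW s_gt0); rewrite -/tree.
have : \sum_(f <- star) edist f.1 f.2 <= n%:R * e.
  rewrite big_map big_seq; apply: (@le_trans _ _ (\sum_(k <- iota 0 n | k \in iota 0 n) e)).
    apply: ler_sum => k; rewrite mem_iota /= => kn; rewrite edistC; exact: cluster_near.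
  by rewrite -big_seq -/(index_iota 0 n) -[n in iota 0 n]subn0 sumr_const_nat subn0 mulr_natl.
have : s * (Zr (Zlength (steiner_tree d)) + 5) <= s * (785 * d%:R + 42).
  by rewrite ler_wpM2l // ltW.
have := e_mul; have := s_gt0; lra.
Qed.

End Clusters.

Lemma open_scaled_ball (R : realType) (n : nat) (A : set (plane R)) (c : plane R) :
  open A -> A c -> exists2 s : R, 0 < s & ball c (n.+1%:R * s) `<=` A.
Proof.
move=> oA Ac; have /nbhs_ballP[r /= r0 rA] : nbhs c A by exact: open_nbhs_nbhs.
by exists (r / n.+1%:R); [exact: divr_gt0|rewrite mulrC divfK].
Qed.

Theorem proposition4p8 (R : realType) (Om : set (plane R)) (d m : nat)
  (Om_nonempty : Om !=set0)
  (Om_open : open Om)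
  (Om_smooth : smooth_domain Om)
  (Om_bounded : bounded_set Om)
  (Om_convex : convex_set Om)
  (hd : d \in [:: 2; 3; 4]%N)
  (hm : (d + 1 <= m)%N) :
  exists mu : {measure set (plane R) -> \bar R},
    in_Ad m d Om mu /\
    forall Gamma : set (plane R),
      Lambda_minimizer m mu Gamma -> connected Gamma.
Proof.
have [c Omc] := Om_nonempty.
have [s s0 sOm] := open_scaled_ball 999 Om_open Omc.
have /andP[d1 d5] : (1 < d < 5)%N by move: hd; rewrite !inE => /or3P[] /eqP ->.
pose pt := cluster_point c s m d; pose n := (m * d)%N.
have [mu muE] := point_measure_exists pt n.
have sptE : spt mu = [set` map pt (iota 0 n)] by exact: spt_point_measure muE.
have pt_uniq : uniq (map pt (iota 0 n)).
  rewrite map_inj_in_uniq ?iota_uniq // => k l; rewrite !mem_iota /= => kn ln.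
  exact: cluster_point_inj.
exists mu; split.
  exists (fun k => pt k); split=> [k l kl|k|A _]; last exact: muE.
  - exact/val_inj/(cluster_point_inj s0 hd hm (ltn_ord k) (ltn_ord l) kl).
  - exact/sOm/cluster_ball.
move=> Gamma [Gred Gmin]; apply: contrapT => nc.
have net_red : Lambda_reduced m mu (competitor c s m d).
  have comp_net Sigma : is_component (competitor c s m d) Sigma ->
      Sigma `&` spt mu = spt mu.
    move=> [y yN SE]; rewrite SE connected_component_id //; last exact: competitor_connected.
    rewrite setIidr // sptE => p /= /mapP[k]; rewrite mem_iota /= => kn ->.
    exact: competitor_point.
  split; first split.
  - exact: net_compact.
  - rewrite sptE => p /= /mapP[k]; rewrite mem_iota /= => kn ->.
    exact: competitor_point.
  - move=> Sigma /comp_net ->; exists d; rewrite sptE mulnC.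
    by have := card_seq pt_uniq; rewrite size_map size_iota.
  - move=> Sigma /comp_net ->; exists (pt 0%N); rewrite sptE /=.
    apply: map_f; rewrite mem_iota /= muln_gt0 (leq_trans _ hm) ?addn1 //=.
    exact: ltnW.
have short := competitor_short c s0 hd hm.
have long : ((s * (785 * d%:R + 42) - 8 * cluster_radius s m d)%:E <= hausdorff1 Gamma)%E.
  apply: (@disconnected_ge R c s _ m d (fun k => pt k) mu) => //.
  - by have := cluster_radius_le m d s0; lra.
  - by rewrite (leq_trans _ hm) // addn1 ltnW.
  - by move=> k; apply: leq_trans (cluster_lt hd hm (ltn_ord k)) _.
  - by move=> k; exact: cluster_near.
  - by move=> k l kl; exact/val_inj/(cluster_point_inj s0 hd hm (ltn_ord k) (ltn_ord l) kl).
  - by rewrite sptE -val_enum_ord -map_comp.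
have := lt_le_trans short (le_trans long (Gmin _ net_red)).
by rewrite ltxx.
Qed.
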